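(* Let $\kappa$ be a regular uncountable cardinal with $\kappa^{<\kappa}=\kappa$. The sets $WF_\alpha$ have the following complexity as $\kappa$-Borel subsets of $\mathcal{P}({}^{<\omega}\kappa)$: (i) For every ordinal $1\le\alpha<\kappa^+$ the set $WF_{\kappa\cdot\alpha}$ is $\Sigma^0_{2\cdot\alpha}$ but not $\Pi^0_{2\cdot\alpha}$. (ii) For every ordinal $\alpha<\kappa^+$ and every $0<\beta<\kappa$ the set $WF_{\kappa\cdot\alpha+\beta}$ is $\Pi^0_{2\cdot\alpha+1}$ but not $\Sigma^0_{2\cdot\alpha+1}$.
   Context: ${}^{<\omega}\kappa$ is the set of finite sequences of ordinals below $\kappa$. $\mathcal{P}({}^{<\omega}\kappa)$ carries the topology (corresponding to ${}^\kappa 2$ with the bounded topology) whose basic clopen sets are the intersections of fewer than $\kappa$ sets of the form $\{T\subseteq{}^{<\omega}\kappa: \eta\in T\}$ or $\{T\subseteq{}^{<\omega}\kappa: \eta\notin T\}$, $\eta\in{}^{<\omega}\kappa$. The $\kappa$-Borel hierarchy on this space: $\Sigma^0_1$ = open sets; for $\alpha>1$, $\Sigma^0_\alpha$ = unions of at most $\kappa$ many sets from $\bigcup_{1\le\beta<\alpha}\Pi^0_\beta$; $\Pi^0_\alpha$ = complements of $\Sigma^0_\alpha$ sets; $\kappa$-Borel sets are those in the smallest class containing open sets closed under complements and unions of size $\le\kappa$. A tree is a subset of ${}^{<\omega}\kappa$ closed under initial segments; it is well-founded if it has no infinite branch. For a well-founded tree $T$, the rank of nodes is $\mathrm{rk}_T(\eta)=0$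 if $\eta$ has no immediate successors and $\mathrm{rk}_T(\eta)=\sup\{\mathrm{rk}_T(\nu)+1:\nu$ an immediate successor of $\eta\}$ otherwise; the rank of $T$ is the rank of its root $\emptyset$. For an ordinal $\alpha\le\kappa^+$, $WF_\alpha=\{x\subseteq{}^{<\omega}\kappa: x$ is a well-founded tree of rank $<\alpha\}$. *)

(* Defs.v *)
From mathcomp Require Import all_boot.
From mathcomp Require Import boolp classical_sets cardinality wochoice.

Set Implicit Arguments.
Unset Strict Implicit.
Unset Printing Implicit Defensive.

Local Open Scope classical_set_scope.
Local Open Scope card_scope.

(* Ordinals as well-founded trees: [osup f] denotes sup {f a + 1 | a : A}.
   Distinct trees may denote the same ordinal; equality of ordinals is [oeq]. *)
Inductive ord : Type := osup (A : Type) (f : A -> ord).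

Fixpoint ole (x y : ord) : Prop :=
  let: osup A f := x in let: osup B g := y in
  forall a : A, exists b : B, ole (f a) (g b).

Definition olt (x y : ord) : Prop :=
  let: osup B g := y in exists b : B, ole x (g b).

Definition oeq (x y : ord) : Prop := ole x y /\ ole y x.

Definition ozero : ord := osup (fun v : void => match v with end).

Definition osucc (x : ord) : ord := osup (fun _ : unit => x).

Definition oone : ord := osucc ozero.

Definition otwo : ord := osucc oone.

(* x + y = {w | w < x} `|` {x + z | z < y} *)
Fixpoint oadd (x y : ord) {struct y} : ord :=
  let: osup A f := x in let: osup B g := y in
  osup (fun s : A + B =>
    match s with inl a => f a | inr b => oadd x (g b) end).

(* x * y = {x * z + w | z < y, w < x}, that is, y copies of x *)
Fixpoint omul (x y : ord) {struct y} : ord :=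
  let: osup A f := x in let: osup B g := y in
  osup (fun p : B * A => oadd (omul x (g p.1)) (f p.2)).

(* rank of a = sup {rank of b + 1 | R b a} *)
Fixpoint acc_rank (A : Type) (R : A -> A -> Prop) (a : A) (h : Acc R a)
    {struct h} : ord :=
  osup (fun b : {b : A | R b a} => acc_rank (Acc_inv h (proj2_sig b))).

(* [well_order le] is about the reflexive order [le]; [strict le] is its strict
   part. *)
Definition strict (T : eqType) (le : rel T) : rel T :=
  fun x y => le x y && (x != y).

Lemma strict_wf (T : eqType) (le : rel T) :
  well_order le -> well_founded (strict le).
Proof.
move=> wo x; apply: contrapT => nx.
have [|z [[zA zmin] _]] := wo (fun y => `[< ~ Acc (strict le) y >]).
  by exists x; apply/asboolP.
move/asboolP: (zA); apply; constructor => y /andP[yz ny].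
apply: contrapT => nAy.
have zy : le z y by apply: zmin; apply/asboolP.
have anti := @wo_chain_antisymmetric T le predT (fun A _ => wo A).
by move/eqP: ny; apply; apply: anti => //; rewrite yz zy.
Qed.

Definition otype (T : eqType) (le : rel T) (wo : well_order le) : ord :=
  osup (fun x : T => acc_rank (strict_wf wo x)).

(* The successor cardinal of |K|: the set of the ordinals of cardinality at
   most |K|, i.e. of the order types of well-orderings of subsets of K. *)
Definition osucc_card (K : eqType) : ord :=
  osup (fun W : {A : pred K & {R : rel {k : K | A k} | well_order R}} =>
    otype (proj2_sig (projT2 W))).

Definition card_lt (T U : Type) (A : set T) (B : set U) : Prop :=
  (A #<= B) /\ ~ (B #<= A).

(* A cardinal kappa is represented by the set K of the ordinals below kappa,
   well-ordered by le. *)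
Section Cardinal.
Variables (K : eqType) (le : rel K).

Definition below (k : K) : set K := [set j | strict le j k].

Definition initial_ordinal : Prop := forall k, card_lt (below k) [set: K].

(* the cofinality is kappa *)
Definition regular : Prop :=
  forall A : set K, (forall k, exists2 a, A a & le k a) -> A #= [set: K].

(* kappa^{<kappa} = kappa: the sequences of elements of K of length < kappa *)
Definition small_powers : Prop :=
  [set: {k : K & {j : K | below k j} -> K}] #= [set: K].

End Cardinal.

Section BorelHierarchy.
Variable K : eqType.
Implicit Types (X : set (set (seq K))) (x : set (seq K)).

Definition subbasic X : Prop :=
  exists eta : seq K, X = [set x | x eta] \/ X = [set x | ~ x eta].

Definition basic X : Prop :=
  exists F : set (set (set (seq K))),
    [/\ F `<=` subbasic, card_lt F [set: K] & X = \bigcap_(U in F) U].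

Definition kopen X : Prop :=
  exists2 F : set (set (set (seq K))), F `<=` basic & X = \bigcup_(U in F) U.

(* Families of at most kappa many sets are indexed by subsets D of K; the sets
   F k belong to Pi^0_(b k). *)
Inductive Sigma0 : ord -> set (set (seq K)) -> Prop :=
| Sigma0_open (alpha : ord) X : oeq alpha oone -> kopen X -> Sigma0 alpha X
| Sigma0_bigcup (alpha : ord) (D : set K) (F : K -> set (set (seq K)))
    (b : K -> ord) :
    olt oone alpha ->
    (forall k, D k -> ole oone (b k) /\ olt (b k) alpha) ->
    (forall k, D k -> Sigma0 (b k) (~` F k)) ->
    Sigma0 alpha (\bigcup_(k in D) F k).

Definition Pi0 (alpha : ord) X : Prop := Sigma0 alpha (~` X).

End BorelHierarchy.

Section Trees.
Variable K : eqType.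
Implicit Types x : set (seq K).

Definition is_tree x : Prop := forall s t : seq K, prefix s t -> x t -> x s.

Definition infinite_branch x (b : nat -> K) : Prop :=
  forall n, x (mkseq b n).

Definition wf_tree x : Prop :=
  is_tree x /\ ~ exists b : nat -> K, infinite_branch x b.

Definition imm_succ x (nu eta : seq K) : Prop :=
  x nu /\ exists k : K, nu = rcons eta k.

Lemma wf_tree_acc x : wf_tree x -> well_founded (imm_succ x).
Proof.
move=> [tx nb] eta; apply: contrapT => neta; apply: nb.
have step (s : {s | ~ Acc (imm_succ x) s}) :
    {k : K | x (rcons (sval s) k) /\ ~ Acc (imm_succ x) (rcons (sval s) k)}.
  apply: cid; apply: contrapT => nk; apply: (svalP s); constructor => nu [xn].
  move=> [k E]; apply: contrapT => nA; apply: nk; exists k; split.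
    by rewrite -E.
  by rewrite -E.
pose nxt s : {s | ~ Acc (imm_succ x) s} :=
    exist (fun s => ~ Acc (imm_succ x) s) _ (svalP (step s)).2.
pose c n := iter n nxt (exist (fun s => ~ Acc (imm_succ x) s) eta neta).
pose e n := sval (step (c n)).
have cE n : sval (c n) = eta ++ mkseq e n.
  elim: n => [|n IH]; first by rewrite cats0.
  by rewrite mkseqS -rcons_cat -IH.
have xc n : x (sval (c n.+1)) := (svalP (step (c n))).1.
pose b n := nth (e 0) (eta ++ mkseq e n.+1) n.
exists b => n; apply: tx (xc n); rewrite cE prefixE size_mkseq.
apply/eqP; apply: (@eq_from_nth _ (e 0)).
  rewrite size_takel ?size_mkseq // size_cat size_mkseq addnS.
  by apply: leqW; exact: leq_addl.
move=> i; rewrite size_takel ?size_cat ?size_mkseq; last first.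
  by rewrite addnS; apply: leqW; exact: leq_addl.
move=> lin; rewrite nth_take // nth_mkseq // /b !nth_cat.
case: ltnP => // le_i; rewrite !nth_mkseq //.
  by rewrite ltnS leq_subr.
by rewrite ltnS (leq_trans (leq_subr _ _)) // ltnW.
Qed.

(* The rank of the root, which is 0 also for the empty tree. *)
Definition tree_rank x (h : wf_tree x) : ord := acc_rank (wf_tree_acc h [::]).

Definition WF (alpha : ord) : set (set (seq K)) :=
  [set x | exists h : wf_tree x, olt (tree_rank h) alpha].

End Trees.

Arguments WF : clear implicits.

(* Main.v *)
Require Import Defs.
From mathcomp Require Import all_boot.
From mathcomp Require Import boolp classical_sets functions cardinality wochoice.

(* Membership in WF_a is a bound on the rank of the root.  Having rank at least
   kappa * a + b is a recursive condition alternating kappa-unions with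
   intersections; for 0 < b < kappa these intersections have fewer than kappa
   members, and by kappa^{<kappa} = kappa they stay in Sigma^0_{2a+1}, while each
   multiple of kappa costs one more intersection of kappa sets.

   For the lower bounds fix d < kappa^+.  For every a there is a continuous map
   (c, x) |-> F c x into trees such that for each Sigma^0_{2a} set A some code c
   gives rank < kappa * a for all x in A and rank >= d for all other x, and
   similarly for Pi^0_{2a+1} sets with rank <= kappa * a.  An intersection is
   handled by joining trees under a new root.  For a union of kappa many sets one
   takes a product of trees T_j, j in K, in which a decreasing sequence of
   ordinals below d controls which T_j have been entered: if every T_j has rank
   at least d, so has the product, while a single T_j of rank at most kappa * b
   bounds it below kappa * (b + 1), because only fewer than kappa many ordinals
   are available before T_j is entered.  If WF_{kappa * a} were Pi^0_{2a}, the
   set {c | F c c is not in WF_{kappa * a}} would be Sigma^0_{2a}, and its code c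
   would give a contradiction. *)

Set Implicit Arguments.
Unset Strict Implicit.
Unset Printing Implicit Defensive.

Local Open Scope classical_set_scope.
Local Open Scope card_scope.

(** * Ordinals *)

Lemma ole_refl x : ole x x.
Proof. by elim: x => A f IH /= a; exists a. Qed.

Lemma ole_trans y x z : ole x y -> ole y z -> ole x z.
Proof.
elim: x y z => A f IH [B g] [C h] /= xy yz a.
have [b ab] := xy a; have [c bc] := yz b.
by exists c; apply: IH ab bc.
Qed.

Lemma olt_ole_trans y x z : olt x y -> ole y z -> olt x z.
Proof.
case: y z => [B g] [C h] /= [b xb] yz; have [c bc] := yz b.
by exists c; apply: ole_trans xb bc.
Qed.

Lemma ole_olt_trans y x z : ole x y -> olt y z -> olt x z.
Proof. by case: z => [C h] /= xy [c yc]; exists c; apply: ole_trans xy yc. Qed.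

Lemma olt_osup A (f : A -> ord) a : olt (f a) (osup f).
Proof. by exists a; apply: ole_refl. Qed.

Lemma olt_ole x y : olt x y -> ole x y.
Proof.
elim: x y => A f IH [B g] [b xb] /= a.
by exists b; apply: IH; apply: olt_ole_trans xb; apply: olt_osup.
Qed.

Lemma olt_trans y x z : olt x y -> olt y z -> olt x z.
Proof. by move=> xy /olt_ole; apply: olt_ole_trans. Qed.

Lemma oleNolt x y : ole x y -> ~ olt y x.
Proof.
elim: x y => A f IH y xy [a ya].
apply: (IH a (f a) (ole_refl _)).
by apply: olt_ole_trans ya; apply: olt_ole_trans xy; apply: olt_osup.
Qed.

Lemma olt_irrefl x : ~ olt x x.
Proof. exact: oleNolt (ole_refl x). Qed.

Lemma ole_osup A (f : A -> ord) y : (forall a, olt (f a) y) -> ole (osup f) y.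
Proof. by case: y => B g; apply. Qed.

Lemma oleP x y : (forall z, olt z x -> olt z y) -> ole x y.
Proof. by case: x => A f fy; apply: ole_osup => a; apply/fy/olt_osup. Qed.

(** If [osup f] is not at most [y], some [f a] is not below [y]. By induction each branch of [y]
    then lies below this [f a], so [y] is at most [f a]. *)
Lemma oleVlt x y : ole x y \/ olt y x.
Proof.
elim: x y => A f IH y.
have [|nle] := EM (ole (osup f) y); [by left|right].
have [a nay] : exists a, ~ olt (f a) y.
  by apply: contrapT => /forallNP nn; apply: nle; apply: ole_osup => a; apply: contrapT.
exists a; case: y nle nay => B g nle nay; apply: ole_osup => b.
by case: (IH a (g b)) => // ab; case: nay; exists b.
Qed.

Lemma not_ole x y : ~ ole x y -> olt y x.
Proof. by case: (oleVlt x y). Qed.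

Lemma not_olt x y : ~ olt x y -> ole y x.
Proof. by case: (oleVlt y x). Qed.

Lemma olt_wf : well_founded olt.
Proof.
elim=> A f IH; constructor => y [a ya].
by constructor => z zy; apply: (Acc_inv (IH a)); apply: olt_ole_trans ya.
Qed.

Lemma ole_zero x : ole ozero x.
Proof. by case: x => B g []. Qed.

Lemma olt_osucc x : olt x (osucc x).
Proof. by exists tt; apply: ole_refl. Qed.

Lemma olt_osuccP x y : olt x (osucc y) <-> ole x y.
Proof. by split => [[[]]|xy] //; exists tt. Qed.

Lemma ole_osuccP x y : ole (osucc x) y <-> olt x y.
Proof.
split=> [|xy]; first exact: olt_ole_trans (olt_osucc x).
by apply: ole_osup.
Qed.

Lemma ole_oneP x : ole oone x <-> olt ozero x.
Proof. exact: ole_osuccP. Qed.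

Lemma oadd_osup A (f : A -> ord) B (g : B -> ord) :
  oadd (osup f) (osup g) = osup (fun s : A + B =>
    match s with inl a => f a | inr b => oadd (osup f) (g b) end).
Proof. by []. Qed.

(** This describes the sum by the ordinals below it, whatever trees represent [x] and [y]; it serves
    as the working definition of addition. *)
Lemma olt_oaddP z x y :
  olt z (oadd x y) <-> olt z x \/ exists2 y', olt y' y & ole z (oadd x y').
Proof.
case: x y => [A f] [B g]; rewrite oadd_osup; split.
  case=> -[a za|b zb]; first by left; exists a.
  by right; exists (g b) => //; apply: olt_osup.
have mono y1 : forall y2, ole y1 y2 -> ole (oadd (osup f) y1) (oadd (osup f) y2).
  elim: y1 => C h IH [D k] hk; rewrite !oadd_osup => -[a|c].
    by exists (inl a); apply: ole_refl.
  by have [d cd] := hk c; exists (inr d); apply: IH.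
case=> [[a za]|[y' [b yb] zy']]; first by exists (inl a).
by exists (inr b); apply: ole_trans zy' (mono _ _ yb).
Qed.

Lemma oadd_lt2l x y z : olt y z -> olt (oadd x y) (oadd x z).
Proof. by move=> yz; apply/olt_oaddP; right; exists y => //; apply: ole_refl. Qed.

Lemma oadd_le2l x y z : ole y z -> ole (oadd x y) (oadd x z).
Proof.
move=> yz; apply: oleP => w /olt_oaddP[wx|[y' y'y wy']]; apply/olt_oaddP; [by left|].
by right; exists y' => //; apply: olt_ole_trans yz.
Qed.

Lemma oadd_le2r x y z : ole x y -> ole (oadd x z) (oadd y z).
Proof.
elim/(well_founded_ind olt_wf): z => z IH xy.
apply: oleP => w /olt_oaddP[wx|[z' z'z wz']]; apply/olt_oaddP.
  by left; apply: olt_ole_trans xy.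
by right; exists z' => //; apply: ole_trans wz' _; apply: IH.
Qed.

Lemma ole_oaddr x y : ole x (oadd x y).
Proof. by apply: oleP => w wx; apply/olt_oaddP; left. Qed.

Lemma oadd0 x y : ole y ozero -> ole (oadd x y) x.
Proof.
move=> y0; apply: oleP => w /olt_oaddP[//|[z zy _]].
by case: (olt_ole_trans zy y0) => -[].
Qed.

Lemma olt_omulP z x y : olt z (omul x y) <->
  exists y' x', [/\ olt y' y, olt x' x & ole z (oadd (omul x y') x')].
Proof.
case: x y => [A f] [B g]; split.
  case=> -[b a] /= zb; exists (g b), (f a); split => //; exact: olt_osup.
have mono y1 : forall y2, ole y1 y2 -> ole (omul (osup f) y1) (omul (osup f) y2).
  elim: y1 => C h IH [D k] hk [c a] /=; have [d cd] := hk c.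
  by exists (d, a) => /=; apply: oadd_le2r; apply: IH.
case=> y' [x' [[b yb] [a xa] zyx]]; exists (b, a) => /=.
apply: ole_trans zyx _; apply: (@ole_trans (oadd (omul (osup f) (g b)) x')).
  by apply: oadd_le2r; apply: mono.
exact: oadd_le2l.
Qed.

Lemma omul_le2l x y z : ole y z -> ole (omul x y) (omul x z).
Proof.
move=> yz; apply: oleP => w /olt_omulP[y' [x' [y'y x'x wyx]]].
by apply/olt_omulP; exists y', x'; split => //; apply: olt_ole_trans yz.
Qed.

Lemma omul_lt x y z w : olt y z -> olt w x ->
  olt (oadd (omul x y) w) (omul x z).
Proof. by move=> yz wx; apply/olt_omulP; exists y, w; split => //; apply: ole_refl. Qed.

Lemma omul0 x y : ole y ozero -> ole (omul x y) ozero.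
Proof.
move=> y0; apply: oleP => w /olt_omulP[y' [x' [y'y _ _]]].
by case: (olt_ole_trans y'y y0) => -[].
Qed.

Lemma omul_oadd_le x y z w : olt y z -> ole w x ->
  ole (oadd (omul x y) w) (omul x z).
Proof.
move=> yz wx; apply: oleP => v /olt_oaddP[/olt_omulP[y' [x' [y'y x'x vyx]]]|].
  by apply/olt_omulP; exists y', x'; split => //; apply: olt_trans yz.
case=> w' w'w vw'; apply/olt_omulP; exists y, w'; split => //.
exact: olt_ole_trans wx.
Qed.

(* 2 * x = sup {2 * y + 2 | y < x} *)
Lemma olt_omul2P z x : olt z (omul otwo x) <->
  exists2 y, olt y x & ole z (oadd (omul otwo y) oone).
Proof.
split=> [/olt_omulP[y [w [yx /olt_osuccP w1 zyw]]]|[y yx zy]].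
  by exists y => //; apply: ole_trans zyw _; apply: oadd_le2l.
by apply/olt_omulP; exists y, oone; split => //; apply: olt_osucc.
Qed.

Lemma olt_omul2S z x :
  olt z (oadd (omul otwo x) oone) <-> ole z (omul otwo x).
Proof.
split=> [/olt_oaddP[/olt_ole//|[y /olt_osuccP y0 zy]]|zx].
  exact: ole_trans zy (oadd0 _ y0).
by apply/olt_oaddP; right; exists ozero; [apply: olt_osucc|
   apply: ole_trans zx (ole_oaddr _ _)].
Qed.

Lemma olt_one_omul2 x : olt ozero x -> olt oone (omul otwo x).
Proof.
move=> x0; apply/olt_omul2P; exists ozero => //.
by apply/ole_oneP/olt_omul2S/ole_zero.
Qed.

(** * Ranks of well-founded relations *)

Section AccRank.
Variables (A : Type) (R : A -> A -> Prop) (R_wf : well_founded R).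

Definition rk a := acc_rank (R_wf a).

(** The recursion runs over accessibility proofs, so each predecessor is ranked through a subproof;
    this replaces it by the proof that [R_wf] gives. *)
Lemma acc_rank_irr a (h1 h2 : Acc R a) : ole (acc_rank h1) (acc_rank h2).
Proof.
elim/(well_founded_ind R_wf): a h1 h2 => a IH [h1] [h2] /= [b Rba].
by exists (exist _ b Rba); apply: IH.
Qed.

Lemma olt_rkP z a : olt z (rk a) <-> exists2 b, R b a & ole z (rk b).
Proof.
rewrite /rk; case: (R_wf a) => h /=; split=> [[[b Rba] /= zb]|[b Rba zb]].
  by exists b => //; apply: ole_trans zb (acc_rank_irr _ _).
by exists (exist _ b Rba) => /=; apply: ole_trans zb (acc_rank_irr _ _).
Qed.

Lemma rk_lt b a : R b a -> olt (rk b) (rk a).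
Proof. by move=> Rba; apply/olt_rkP; exists b => //; apply: ole_refl. Qed.

End AccRank.

(* The range of r may contain further ordinals. *)
Definition enumerates (I : Type) (x : ord) (r : I -> ord) : Prop :=
  forall z, olt z x -> exists k, oeq z (r k).

(** Start from an index bounding [z] and pass to smaller values of [r] that are still at least [z].
    By well-foundedness the descent stops, and it can only stop at [z]. *)
Lemma enumerates_approx (I : Type) (x : ord) (r : I -> ord) :
  (forall z, olt z x -> exists2 k, ole z (r k) & olt (r k) x) ->
  (forall k z, olt z (r k) -> exists2 k', ole z (r k') & olt (r k') (r k)) ->
  enumerates x r.
Proof.
move=> rx rr z zx; have [k zk _] := rx z zx.
move: {2}(r k) (ole_refl (r k)) => w; elim/(well_founded_ind olt_wf): w k zk.
move=> w IH k zk kw; have [kz|/rr[k' zk' k'k]] := oleVlt (r k) z.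
  by exists k; split.
exact: IH (olt_ole_trans k'k kw) _ zk' (ole_refl _).
Qed.

(** * Cardinality *)

Lemma card_le_injP T U (A : set T) (B : set U) : A #<= B ->
  exists2 g : {x | A x} -> U, (forall x, B (g x)) & injective g.
Proof.
move=> /card_leP[f].
pose i (x : {x | A x}) : A := SigSub (mem_set (proj2_sig x)).
exists (fun x => val (f (i x))) => [x|x y /val_inj /(@inj _ _ _ f)].
  exact: set_mem (valP (f (i x))).
move=> /(_ (mem_set I) (mem_set I)) /(congr1 val) /= E.
case: x y E => [x Ax] [y Ay] /= E; case: _ / E in Ay *.
by rewrite (Prop_irrelevance Ax Ay).
Qed.

Lemma injective_card_le T U (A : set T) (B : set U) (f : T -> U) :
  (forall x, A x -> B (f x)) ->
  (forall x y, A x -> A y -> f x = f y -> x = y) -> A #<= B.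
Proof.
move=> fB finj; have : $|{injfun A >-> B}|.
  by apply/injfunPex; exists f => // x y /set_mem Ax /set_mem Ay; apply: finj.
by case=> g; apply: inj_card_le.
Qed.

Lemma injective_cancel T U (f : T -> U) (x0 : T) :
  injective f -> exists g, cancel f g.
Proof.
move=> finj.
have : forall y, exists x, forall x', f x' = y -> x' = x.
  move=> y; have [[x fx]|nx] := EM (exists x, f x = y).
    by exists x => x' fx'; apply: finj; rewrite fx'.
  by exists x0 => x' fx'; case: nx; exists x'.
by move=> /choice[g gP]; exists g => x; apply/esym/gP.
Qed.

(** * Well-orders and the ranks of their points *)

Section WellOrder.
Variables (K : eqType) (le : rel K) (le_wo : well_order le).
Local Notation lt := (strict le).

Lemma wo_refl k : le k k.
Proof. by have r := @wo_chain_reflexive _ le predT (fun A _ => @le_wo A); apply: r. Qed.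

Lemma wo_anti k j : le k j -> le j k -> k = j.
Proof.
move=> kj jk; have anti := @wo_chain_antisymmetric _ le predT (fun A _ => @le_wo A).
by apply: anti; rewrite ?kj.
Qed.

Lemma wo_total k j : le k j || le j k.
Proof. by have t := @wo_chainW _ le predT (fun A _ => @le_wo A); apply: t. Qed.

Lemma wo_max k j : exists i, le k i /\ le j i.
Proof.
by have := wo_refl; case/orP: (wo_total k j) => kj ?; [exists j|exists k].
Qed.

Lemma lt_irr k : ~ lt k k.
Proof. by case/andP => _ /eqP. Qed.

Lemma lt_le k j : lt k j -> le k j.
Proof. by case/andP. Qed.

Lemma le_not_lt k j : le k j -> ~ lt j k.
Proof. by move=> kj /andP[jk /eqP]; apply; apply: wo_anti. Qed.

Lemma not_lt_le k j : ~ lt k j -> le j k.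
Proof.
move=> nkj; have [->|ne] := eqVneq j k; first exact: wo_refl.
by case/orP: (wo_total k j) => // kj; case: nkj; rewrite /strict kj eq_sym.
Qed.

Lemma wo_trans j k i : le k j -> le j i -> le k i.
Proof.
move=> kj ji.
have [z [[zA zmin] _]] := @le_wo (mem [:: k; j; i]) (ex_intro _ k (mem_head _ _)).
have zm x : x \in [:: k; j; i] -> le z x by move=> xA; apply: zmin.
have := zA; rewrite !inE => /or3P[] /eqP zE.
- by rewrite -zE; apply: zm; rewrite !inE eqxx !orbT.
- have -> // : k = j by apply: wo_anti kj _; rewrite -zE zm // !inE eqxx.
- have <- // : j = i by apply: wo_anti ji _; rewrite -zE zm // !inE eqxx orbT.
Qed.

Lemma lt_le_trans j k i : lt k j -> le j i -> lt k i.
Proof.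
move=> kj ji; rewrite /strict (wo_trans (lt_le kj) ji) /=.
by apply/eqP => ki; apply: (le_not_lt ji); rewrite -ki.
Qed.

Lemma lt_total k j : k <> j -> lt k j \/ lt j k.
Proof.
move=> kj; have [|/not_lt_le jk] := EM (lt k j); [by left|right].
by rewrite /strict jk eq_sym; apply/eqP.
Qed.

Definition krk k := rk (strict_wf le_wo) k.

Lemma krk_lt j k : lt j k -> olt (krk j) (krk k).
Proof. exact: rk_lt. Qed.

Lemma krk_le j k : le j k -> ole (krk j) (krk k).
Proof.
have [-> _|/eqP jk jlek] := eqVneq j k; first exact: ole_refl.
by apply/olt_ole/krk_lt; rewrite /strict jlek; apply/eqP.
Qed.

(** Take the least [j] whose rank is at least [z]. If that rank exceeded [z], a point below [j]
    would already qualify. *)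
Lemma olt_krkP z k : olt z (krk k) <-> exists2 j, lt j k & oeq z (krk j).
Proof.
split=> [zk|[j jk [zj _]]]; last by apply/olt_rkP; exists j.
have [j [[jz jm] _]] := @le_wo (fun j => `[< ole z (krk j) >])
  (ex_intro _ k (asboolT (olt_ole zk))).
move/asboolP: jz => zj.
have jz : ole (krk j) z.
  apply: not_olt => /olt_rkP[i ij zi].
  by apply: (le_not_lt _ ij); apply: jm; apply/asboolP.
exists j => //; apply: contrapT => /not_lt_le /krk_le kj.
by apply: (olt_irrefl (x := z)); apply: olt_ole_trans zk (ole_trans kj jz).
Qed.

Lemma krk_inj k j : oeq (krk k) (krk j) -> k = j.
Proof.
move=> [kj jk]; apply: contrapT => /lt_total[] /(rk_lt (strict_wf le_wo)).
  exact: oleNolt.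
exact: oleNolt.
Qed.

Lemma olt_otypeP z : olt z (otype le_wo) <-> exists k, oeq z (krk k).
Proof.
split=> [[k zk]|[k [zk _]]]; last by exists k.
have [kz|] := oleVlt (krk k) z; first by exists k; split.
by move=> /olt_krkP[j _ zj]; exists j.
Qed.

End WellOrder.

(** * Ranks of trees *)

Section RankGe.
Variable K : eqType.
Implicit Types (x : set (seq K)) (s : seq K) (a b : ord).

(* On an infinite branch this holds for every a. *)
Fixpoint rank_ge (a : ord) x s : Prop :=
  let: osup A f := a in
  forall i : A, exists k, x (rcons s k) /\ rank_ge (f i) x (rcons s k).

Lemma rank_ge_ole a b x s : ole a b -> rank_ge b x s -> rank_ge a x s.
Proof.
elim: a b s => A f IH [B g] s ab bb i; have [j ij] := ab i.
by have [k [xk bk]] := bb j; exists k; split=> //; apply: IH bk.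
Qed.

Lemma rank_geP a x s : rank_ge a x s <->
  forall b, olt b a -> exists k, x (rcons s k) /\ rank_ge b x (rcons s k).
Proof.
split=> [|H].
  case: a => A f H b [i bi]; have [k [xk fk]] := H i.
  by exists k; split=> //; apply: rank_ge_ole fk.
by case: a H => A f H i; apply/H/olt_osup.
Qed.

Lemma rank_ge_osuccP a x s :
  rank_ge (osucc a) x s <-> exists k, x (rcons s k) /\ rank_ge a x (rcons s k).
Proof. by split=> [/(_ tt)|H []]. Qed.

Lemma rank_ge_acc x (w : well_founded (imm_succ x)) a s :
  rank_ge a x s <-> ole a (rk w s).
Proof.
elim/(well_founded_ind w): s a => s IH a; split=> [/rank_geP H|as_].
  apply: oleP => b /H[k [xk bk]]; apply/olt_rkP; exists (rcons s k).
    by split=> //; exists k.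
  by apply/IH => //; split=> //; exists k.
apply/rank_geP => b ba; have /olt_rkP[t [xt [k tk]] bt] := olt_ole_trans ba as_.
by subst t; exists k; split=> //; apply/IH => //; split=> //; exists k.
Qed.

Lemma rank_ge_branch x f a n : infinite_branch x f -> rank_ge a x (mkseq f n).
Proof.
by move=> xf; elim: a n => A g IH n /= i; exists (f n); rewrite -mkseqS; split.
Qed.

(** An infinite branch would make [rank_ge a] hold at the root, so its failure yields
    well-foundedness together with the bound on the rank. *)
Lemma WFP a x : WF K a x <-> is_tree x /\ ~ rank_ge a x [::].
Proof.
split=> [[w /= xa]|[xt nb]].
  split; first by case: (w).
  by move=> /(rank_ge_acc (wf_tree_acc w)); move: xa => /[swap] /oleNolt.
have w : wf_tree x by split=> // -[f xf]; apply: nb; apply: (rank_ge_branch a 0 xf).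
by exists w; apply: not_ole => H; apply: nb; apply/(rank_ge_acc (wf_tree_acc w)).
Qed.

End RankGe.

(** * Ordinals of cardinality at most kappa *)

Section Enumerable.
Variable K : eqType.

Definition enumerable (a : ord) : Prop := exists r : K -> ord, enumerates a r.

Lemma enumerable_ole a b : ole a b -> enumerable b -> enumerable a.
Proof. by move=> ab [r rP]; exists r => z za; apply/rP/(olt_ole_trans za). Qed.

Lemma enumerable_osucc_card a : olt a (osucc_card K) -> enumerable a.
Proof.
case=> -[A [R wo]] /= aR; apply: enumerable_ole aR _.
(* Points outside [A] get the default [ozero], which is harmless because an enumeration may take
   further values. *)
exists (fun k => match insub k : option {k | A k} with
  | Some v => krk wo v | None => ozero end) => z /olt_otypeP[v zv].
by exists (val v); rewrite valK.
Qed.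

End Enumerable.

(** * A regular cardinal kappa *)

Section Kappa.
Variables (K : eqType) (le : rel K) (le_wo : well_order le).
Hypotheses (K_initial : initial_ordinal le) (K_regular : regular le).
Hypotheses (K_uncountable : ~ countable [set: K]).
Hypothesis K_powers : small_powers le.
Local Notation lt := (strict le).
Local Notation X := (set (seq K)).
Local Notation kappa := (otype le_wo).

Lemma K_inhabited : inhabited K.
Proof.
apply: contrapT => nK; apply: K_uncountable.
by apply: (injective_card_le (f := fun=> 0)) => // k; case: nK; exists.
Qed.

(** A largest point would form a cofinal singleton, and by regularity [K] would have one element. *)
Lemma exists_gt k : exists j, lt k j.
Proof.
apply: contrapT => /forallNP nj; apply: K_uncountable.
have : [set k] #= [set: K].
  by apply: K_regular => j; exists k => //; apply: (not_lt_le le_wo); apply: nj.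
rewrite card_eq_sym => /card_eqPle[kl _].
have [g gk ginj] := card_le_injP kl.
apply: (injective_card_le (f := fun=> 0)) => // x y _ _ _.
have {}gk z z' : g z = g z' by rewrite !(gk _ : g _ = k).
exact: (congr1 (@proj1_sig _ _) (ginj (exist _ x I) (exist _ y I) (gk _ _))).
Qed.

Definition bounded (T : Type) (h : T -> K) (A : set T) :=
  exists k, forall x, A x -> lt (h x) k.

(** An unbounded image has size kappa by regularity; a bounded one lies in a proper initial segment,
    which is smaller than kappa since kappa is an initial ordinal. *)
Lemma card_lt_bounded (T : Type) (h : T -> K) (A : set T) :
  injective h -> card_lt A [set: K] <-> bounded h A.
Proof.
move=> hinj; split=> [[_ nA]|[k kA]].
  apply: contrapT => /forallNP nb; apply: nA.
  have : h @` A #= [set: K].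
    apply: K_regular => k; have /existsNP[x /not_implyP[Ax nxk]] := nb k.
    by exists (h x); [exists x|apply: (not_lt_le le_wo)].
  rewrite card_eq_sym => /card_eqPle[kl _]; apply: card_le_trans kl _.
  exact: card_image_le.
have Ak : A #<= below le k by apply: (injective_card_le (f := h)) => // x y _ _ /hinj.
split; first by apply: card_le_trans Ak (card_leT _).
by move=> KA; have [_] := K_initial k; apply; apply: card_le_trans KA Ak.
Qed.

Lemma bounded_fun (T : Type) (h : T -> K) (A : set T) (f : T -> K) :
  injective h -> bounded h A -> exists k, forall x, A x -> lt (f x) k.
Proof.
move=> hinj /(card_lt_bounded _ hinj)[AK nKA].
have [k fk] : bounded id (f @` A).
  apply/card_lt_bounded => //; split; first exact: card_leT.
  by move=> /card_le_trans /(_ (card_image_le f A)).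
by exists k => x Ax; apply: fk; exists x.
Qed.

(** By kappa^{<kappa} = kappa, points of [K] code sequences of length below kappa: [l] decodes the
    length and [u] the entries. *)
Lemma exists_fun_code : exists (l : K -> K) (u : K -> K -> K),
  forall (k : K) (v : K -> K), exists m,
    l m = k /\ forall j, lt j k -> u m j = v j.
Proof.
have [k0] := K_inhabited.
have /card_eqPle[kl _] := K_powers.
have [c _ cinj] := card_le_injP kl.
pose P := {k : K & {j : K | below le k j} -> K}.
pose c' (x : P) := c (exist _ x I).
have c'inj : injective c' by move=> x y /cinj[].
have [d dK] := injective_cancel (existT _ k0 (fun=> k0) : P) c'inj.
exists (fun m => projT1 (d m)), (fun m j =>
  match pselect (below le (projT1 (d m)) j) with
  | left H => projT2 (d m) (exist _ j H) | right _ => k0 end).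
move=> k v; exists (c' (existT _ k (fun j => v (proj1_sig j)))); rewrite dK.
by split=> // j jk; case: pselect.
Qed.

(** The strictly increasing [nu] embeds the natural numbers in [K], so a finite sequence is coded as
    one of length [nu (size s)]. *)
Lemma exists_seq_code : exists h : seq K -> K, injective h.
Proof.
have [k0] := K_inhabited.
have [l [u luP]] := exists_fun_code.
have [nxt nxtP] := choice exists_gt.
pose nu n := iter n nxt k0.
have nu_lt n m : n < m -> lt (nu n) (nu m).
  elim: m => // m IH; rewrite ltnS leq_eqVlt => /orP[/eqP->|/IH nm]; first exact: nxtP.
  by apply: (lt_le_trans le_wo) nm _; apply/lt_le/nxtP.
have nuinj : injective nu.
  move=> n m E; case: (ltngtP n m) => // /nu_lt; rewrite E => /lt_irr //.
have [ix ixK] := injective_cancel 0 nuinj.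
have /choice[h hP] (s : seq K) := luP (nu (size s)) (fun j => nth k0 s (ix j)).
exists h => s t st.
have [hs us] := hP s; have [ht ut] := hP t.
have sst : size s = size t by apply: nuinj; rewrite -hs -ht st.
apply: (@eq_from_nth _ k0) => // i si.
rewrite -[i]ixK -us ?nu_lt // st ut ?nu_lt -?sst //.
Qed.

Lemma exists_pair_code : exists p : K -> K * K, forall x, exists k, p k = x.
Proof.
have [k0] := K_inhabited; have [h hinj] := exists_seq_code.
have pinj : injective (fun x : K * K => h [:: x.1; x.2]).
  by move=> [a b] [c d] /hinj[-> ->].
have [p pK] := injective_cancel (k0, k0) pinj.
by exists p => x; eexists; apply: pK.
Qed.

(* Codes in K: h s for the sequence s, m for the restriction of u m to the
   predecessors of l m, and k for the pair p k. *)
Variables (h : seq K -> K) (h_inj : injective h).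
Variables (l : K -> K) (u : K -> K -> K).
Hypothesis luP : forall (k : K) (v : K -> K), exists m,
  l m = k /\ forall j, lt j k -> u m j = v j.
Variable (p : K -> K * K).
Hypothesis p_surj : forall x, exists k, p k = x.

Implicit Types (U V : set X) (x y : X).

(** * The bounded topology *)

Definition agree (k : K) (x y : X) : Prop :=
  forall s, lt (h s) k -> (x s <-> y s).

Lemma agree_le k j x y : le k j -> agree j x y -> agree k x y.
Proof. by move=> kj xy s sk; apply/xy/(lt_le_trans le_wo sk). Qed.

Lemma agree_sym k x y : agree k x y -> agree k y x.
Proof. by move=> xy s /xy[]. Qed.

(** A basic set constrains fewer than kappa nodes, whose codes are bounded by regularity.
    Conversely, agreement with [x] up to [k] is an intersection of fewer than kappa subbasic
    sets. *)
Lemma kopenP U :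
  kopen U <-> forall x, U x -> exists k, forall y, agree k x y -> U y.
Proof.
split=> [[F FB ->] x [V FV Vx]|UP].
  have [G [GS [GK nKG] VE]] := FB _ FV.
  have /choice[e eP] (W : set X) : exists e : seq K, subbasic W ->
      W = [set x | x e] \/ W = [set x | ~ x e].
    have [[e We]|nW] := EM (subbasic W); first by exists e.
    by exists [::] => /nW.
  have [k kP] : bounded id ((h \o e) @` G).
    apply/card_lt_bounded => //; split; first exact: card_leT.
    by move=> /card_le_trans /(_ (card_image_le _ G)).
  exists k => y xy; exists V => //; rewrite VE => W GW.
  have := Vx; rewrite VE => /(_ _ GW).
  have /xy : lt (h (e W)) k by apply: kP; exists W.
  move: (e W) (eP W (GS _ GW)) => s; case=> -> /= [xy1 xy2]; tauto.
exists [set V | basic V /\ V `<=` U] => [V []//|].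
apply/seteqP; split=> [x Ux|x [V [_ VU] Vx]]; last exact: VU.
have [k kU] := UP x Ux.
pose W s : set X := [set y | y s <-> x s].
pose A := [set s | lt (h s) k].
exists (\bigcap_(V in W @` A) V); last by move=> _ [s _ <-].
split => [|y yW]; last first.
  apply: kU => s sk; have : W s y by apply: yW; exists s.
  by rewrite /W /=; tauto.
exists (W @` A); split => //.
  move=> _ [s _ <-]; exists s; have [xs|nxs] := EM (x s).
    by left; apply/seteqP; split=> y; rewrite /W /=; tauto.
  by right; apply/seteqP; split=> y; rewrite /W /=; tauto.
have [_ nKA] : card_lt A [set: K].
  by apply/(card_lt_bounded _ h_inj); exists k.
split; last by move=> /card_le_trans /(_ (card_image_le _ A)).
have [k0] := K_inhabited.
apply: card_le_trans (card_image_le W A) _.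
by apply: (injective_card_le (f := h)) => // s t _ _ /h_inj.
Qed.

(** More uniform than continuity: [k] depends on the node [s] only, not on the point. *)
Definition cont (f : X -> X) : Prop :=
  forall s, exists k, forall x y, agree k x y -> (f x s <-> f y s).

Lemma kopen_preimage f U : cont f -> kopen U -> kopen (f @^-1` U).
Proof.
move=> /choice[kf fc] /kopenP UP; apply/kopenP => x /UP[k kU].
have [j jP] : exists j, forall s, lt (h s) k -> lt (kf s) j.
  by apply: (bounded_fun kf h_inj); exists k.
exists j => y xy; apply: kU => s sk; apply: fc.
by apply: agree_le xy; apply/lt_le/jP.
Qed.

Lemma Sigma0_preimage a f U : cont f -> Sigma0 a U -> Sigma0 a (f @^-1` U).
Proof.
move=> fc; elim=> [a' V a1 Vo|a' D F b a1 bP _ IH].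
  by apply: Sigma0_open => //; apply: kopen_preimage.
by rewrite preimage_bigcup; apply: (Sigma0_bigcup (b := b)).
Qed.

(** * The Borel hierarchy *)

Lemma Sigma0_ge1 a U : Sigma0 a U -> ole oone a.
Proof. by case=> [a' V [] //|a' D F b /olt_ole]. Qed.

Lemma Sigma0_kopen a U : ole a oone -> Sigma0 a U -> kopen U.
Proof. by move=> + aU; case: aU => // a' D F b a1 _ _ /oleNolt. Qed.

(* The restriction of [u m] below [l m] codes an initial piece of a point of X:
   the value at [h s] is the least element of K exactly when s is a member. *)
Definition nbhd (m : K) : set X := [set y | forall s, lt (h s) (l m) ->
  (y s <-> forall j, le (u m (h s)) j)].

Lemma kopen_nbhdC m : kopen (~` nbhd m).
Proof.
apply/kopenP => x nx; exists (l m) => y xy yN; apply: nx => s sm.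
by rewrite (xy _ sm); apply: yN.
Qed.

Lemma kopen_nbhd U x : kopen U -> U x -> exists2 m, nbhd m x & nbhd m `<=` U.
Proof.
move=> Uo Ux; have [k kU] := (kopenP U).1 Uo x Ux.
have [k0 k0P] : exists k0, forall j, le k0 j.
  have [k0] := K_inhabited.
  have [z [[_ zmin] _]] := @le_wo predT (ex_intro _ k0 isT).
  by exists z => j; apply: zmin.
have [k1 k1P] := exists_gt k0.
have [h' h'K] := injective_cancel [::] h_inj.
have [m [mk um]] := luP k (fun j => if `[< x (h' j) >] then k0 else k1).
have xN s : lt (h s) k -> (forall j, le (u m (h s)) j) <-> x s.
  move=> sk; rewrite um // h'K; case: asboolP => // nxs.
  by split=> // /(_ k0) /(le_not_lt le_wo).
exists m; first by move=> s; rewrite mk => sk; rewrite xN.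
by move=> y yN; apply: kU => s sk; rewrite (yN s) ?mk // xN.
Qed.

(** An open set is the union of the sets [nbhd m] inside it. There are at most kappa of them, and
    each is closed. *)
Lemma Sigma0_of_kopen a U : ole oone a -> kopen U -> Sigma0 a U.
Proof.
move=> a1 Uo; have [a1'|lta] := oleVlt a oone; first exact: Sigma0_open.
have -> : U = \bigcup_(m in [set m | nbhd m `<=` U]) nbhd m.
  apply/seteqP; split=> [x Ux|x [m mU /mU]//].
  by have [m mx mU] := kopen_nbhd Uo Ux; exists m.
apply: (Sigma0_bigcup (b := fun=> oone)) => // [_ _|m _].
  by split=> //; apply: ole_refl.
by apply: Sigma0_open (kopen_nbhdC m); split; apply: ole_refl.
Qed.

Lemma Sigma0_ole a b U : ole a b -> Sigma0 a U -> Sigma0 b U.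
Proof.
move=> + aU; case: aU => [a' V [_ a1] Vo ab|a' D F c a1 cP cF ab].
  by apply: Sigma0_of_kopen => //; apply: ole_trans ab.
apply: (Sigma0_bigcup (b := c)) => // [|k /cP[c1 ca]].
  exact: olt_ole_trans ab.
by split=> //; apply: olt_ole_trans ab.
Qed.

Lemma kopenT : kopen [set: X].
Proof.
by apply/kopenP => x _; have [k0] := K_inhabited; exists k0.
Qed.

Lemma kopen0 : kopen (@set0 X).
Proof. by apply/kopenP => x. Qed.

Lemma Sigma0P a U : olt oone a ->
  Sigma0 a U <-> exists F : K -> set X,
    (forall k, exists2 b, olt b a & Pi0 b (F k)) /\ U = \bigcup_k F k.
Proof.
move=> a1; split=> [aU|[F [FP ->]]].
  case: aU a1 => [a' V [_ a1] _ /oleNolt//|a' D F b _ bP Fb a1].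
  (* Indices outside [D] receive the empty set, which is Pi^0_1. *)
  exists (fun k => [set x | D k /\ F k x]); split.
    move=> k; have [Dk|nDk] := EM (D k).
      have [b1 ba] := bP k Dk; exists (b k) => //; rewrite /Pi0.
      rewrite (_ : [set _ | _] = F k); first exact: Fb.
      by apply/seteqP; split=> // x [].
    exists oone => //; rewrite /Pi0 (_ : ~` _ = setT).
      by apply: Sigma0_of_kopen kopenT; apply: ole_refl.
    by apply/seteqP; split=> // x _ [].
  by apply/seteqP; split=> x [k]; [move=> Dk kx|move=> _ [Dk kx]]; exists k.
have /choice[b bP] (k : K) : exists b, olt b a /\ Pi0 b (F k).
  by have [b ba bF] := FP k; exists b.
apply: (Sigma0_bigcup (b := b)) => // k _;
  have [bk kF] := bP k; last exact: kF.
by split=> //; apply: Sigma0_ge1 kF.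
Qed.

Lemma Sigma0_bigcupK a (U : K -> set X) : ole oone a ->
  (forall k, Sigma0 a (U k)) -> Sigma0 a (\bigcup_k U k).
Proof.
move=> a1 Ua; have [a1'|lta] := oleVlt a oone.
  apply: Sigma0_open => //; apply/kopenP => x [k _ kx].
  have [j jP] := (kopenP (U k)).1 (Sigma0_kopen a1' (Ua k)) x kx.
  by exists j => y /jP; exists k.
have /choice[F FP] k := (Sigma0P _ lta).1 (Ua k).
apply/Sigma0P => //; exists (fun k => F (p k).1 (p k).2); split.
  by move=> k; have [+ _] := FP (p k).1; apply.
apply/seteqP; split=> x [k _].
  have [_ ->] := FP k => -[j _ jx]; have [i pi] := p_surj (k, j).
  by exists i => //; rewrite pi.
move=> kx; exists (p k).1 => //; have [_ ->] := FP (p k).1.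
by exists (p k).2.
Qed.

Lemma Pi0_bigcapK a (U : K -> set X) : ole oone a ->
  (forall k, Pi0 a (U k)) -> Pi0 a (\bigcap_k U k).
Proof. by move=> a1 Ua; rewrite /Pi0 setC_bigcap; apply: Sigma0_bigcupK. Qed.

Lemma Sigma0_setU a U V : Sigma0 a U -> Sigma0 a V -> Sigma0 a (U `|` V).
Proof.
move=> aU aV; have [k0] := K_inhabited.
have [k1 k01] := exists_gt k0.
rewrite (_ : _ `|` _ = \bigcup_k (if k == k0 then U else V)).
  by apply: Sigma0_bigcupK (Sigma0_ge1 aU) _ => k; case: ifP.
apply/seteqP; split=> [x [Ux|Vx]|x [k _]]; last by case: ifP; [left|right].
  by exists k0; rewrite ?eqxx.
by exists k1 => //; case: eqP => // k10; move: k01; rewrite k10 => /lt_irr.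
Qed.

Lemma Pi0_of_small_cap a (U : K -> set X) k : ole oone a ->
  (forall i, lt i k -> Pi0 a (U i)) -> Pi0 a [set x | forall i, lt i k -> U i x].
Proof.
move=> a1 Ua; rewrite (_ : [set _ | _] = \bigcap_i [set x | lt i k -> U i x]).
  apply: Pi0_bigcapK => // i; have [ik|nik] := EM (lt i k).
    rewrite (_ : [set _ | _] = U i); first exact: Ua.
    by apply/seteqP; split=> x /=; tauto.
  rewrite /Pi0 (_ : ~` _ = set0); first exact: Sigma0_of_kopen kopen0.
  by apply/seteqP; split=> // x /= []/nik.
by apply/seteqP; split=> x /= H i => [_|]; apply: H.
Qed.

(* Distributivity: an intersection of fewer than kappa many kappa-unions is a
   union over choice functions, of which there are only kappa many. *)
Lemma Sigma0_small_cap a (U : K -> set X) k (a' := oadd (omul otwo a) oone) :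
  (forall i, lt i k -> Sigma0 a' (U i)) ->
  Sigma0 a' [set x | forall i, lt i k -> U i x].
Proof.
move=> Ua; have a'1 : ole oone a' by apply/ole_oneP/olt_omul2S/ole_zero.
(* For [a] zero the level is 1, and regularity makes an intersection of fewer than kappa open sets
   open. *)
have [a0|a0] := oleVlt a ozero.
  have a1 : ole a' oone.
    apply: ole_trans (oadd_le2r _ (omul0 otwo a0)) _.
    by apply: oleP => z /olt_oaddP[[[]]|[y /olt_osuccP y0 zy]];
       apply/olt_osuccP; apply: ole_trans zy (oadd0 _ y0).
  apply: Sigma0_open => //; apply/kopenP => x xU.
  have /choice[f fP] i : exists j, lt i k -> forall y, agree j x y -> U i y.
    have [ik|nik] := EM (lt i k); last by exists i.
    have [j jP] := (kopenP _).1 (Sigma0_kopen a1 (Ua i ik)) x (xU i ik).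
    by exists j.
  have [j jP] : exists j, forall i, lt i k -> lt (f i) j.
    by apply: (bounded_fun f (@inj_id _)); exists k.
  by exists j => y xy i ik; apply: fP => //; apply: agree_le xy; apply/lt_le/jP.
have lta : olt oone a' by apply: olt_ole_trans (olt_one_omul2 a0) (ole_oaddr _ _).
have /choice[F FP] i : exists F : K -> set X, lt i k ->
    (forall j, Pi0 (omul otwo a) (F j)) /\ U i = \bigcup_j F j.
  have [ik|nik] := EM (lt i k); last by exists (fun=> set0).
  have [F [FP UF]] := (Sigma0P _ lta).1 (Ua i ik); exists F => _; split => // j.
  by have [b /olt_omul2S ba] := FP j; apply: Sigma0_ole.
apply/Sigma0P => //; exists (fun m => [set x | forall i, lt i k -> F i (u m i) x]).
split.
  move=> m; exists (omul otwo a); first exact/olt_omul2S/ole_refl.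
  apply: Pi0_of_small_cap => [|i ik]; first exact/olt_ole/olt_one_omul2.
  by have [+ _] := FP i ik; apply.
apply/seteqP; split=> [x xU|x [m _ xm] i ik]; last first.
  by have [_ ->] := FP i ik; exists (u m i) => //; apply: xm.
have /choice[v vP] i : exists j, lt i k -> F i j x.
  have [ik|nik] := EM (lt i k); last by exists i.
  by have := xU i ik; have [_ ->] := FP i ik => -[j _ jx]; exists j.
have [m [_ um]] := luP k v.
by exists m => // i ik; rewrite um //; apply: vP.
Qed.

(** * Upper bounds *)

Lemma olt_osucc_krk k : olt (osucc (krk le_wo k)) kappa.
Proof.
have [j kj] := exists_gt k.
by exists j; apply/ole_osuccP; exact: krk_lt.
Qed.

(** Every ordinal below kappa * a is at most some kappa * y + w with y < a and w < kappa. The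
    successor is there because rank at least z + 1 is what provides a child of rank at least z. *)
Lemma rank_ge_omulP a (r : K -> ord) (x : X) s : enumerates a r ->
  rank_ge (omul kappa a) x s <-> forall j k, olt (r j) a ->
    rank_ge (oadd (omul kappa (r j)) (osucc (krk le_wo k))) x s.
Proof.
move=> ra; split=> [H j k ja|H].
  apply: rank_ge_ole H; apply: omul_oadd_le => //.
  exact/olt_ole/olt_osucc_krk.
apply/rank_geP => z /olt_omulP[y [w [ya /olt_otypeP[k wk] zyw]]].
have [j [yj jy]] := ra y ya.
move: (H j k (ole_olt_trans jy ya)) => /rank_geP; apply.
apply/olt_oaddP; right; exists (krk le_wo k); first exact: olt_osucc.
apply: ole_trans zyw _; apply: ole_trans (oadd_le2l _ wk.1) _.
by apply: oadd_le2r; apply: omul_le2l.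
Qed.

Lemma Sigma0_of_Pi0_lt a b (U : set X) : olt oone a -> olt b a -> Pi0 b U -> Sigma0 a U.
Proof.
move=> a1 ba bU; have [k0] := K_inhabited.
apply/(Sigma0P U a1).
exists (fun=> U); split; first by exists b.
by apply/seteqP; split=> [x Ux|x []//]; exists k0.
Qed.

Lemma Pi0_of_Sigma0_lt a b (U : set X) : olt oone a -> olt b a -> Sigma0 b U -> Pi0 a U.
Proof.
move=> a1 ba bU; apply: Sigma0_of_Pi0_lt a1 ba _.
by rewrite /Pi0 setCK.
Qed.

Lemma Sigma0_setI a (U V : set X) (a' := oadd (omul otwo a) oone) :
  Sigma0 a' U -> Sigma0 a' V -> Sigma0 a' (U `&` V).
Proof.
move=> aU aV; have [k0] := K_inhabited.
have [k1 k01] := exists_gt k0.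
have [k2 k12] := exists_gt k1.
have k02 := lt_le_trans le_wo k01 (lt_le k12).
rewrite (_ : U `&` V = [set x | forall i, lt i k2 -> (if i == k0 then U else V) x]).
  apply: Sigma0_small_cap.
  by move=> i _; case: ifP.
apply/seteqP; split=> x /= => [[Ux Vx] i _|H]; first by case: ifP.
have := H k0 k02; rewrite eqxx; split=> //.
by have := H k1 k12; case: eqP => // E; move: k01; rewrite E => /lt_irr.
Qed.

Lemma kopen_mem s : kopen [set x : X | x s].
Proof.
apply/kopenP => x xs.
have [k sk] := exists_gt (h s).
by exists k => y xy; apply/xy.
Qed.

Lemma kopen_not_tree : kopen [set x : X | ~ is_tree x].
Proof.
apply/kopenP => x.
move=> /existsNP[s /existsNP[t /not_implyP[st /not_implyP[xt nxs]]]].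
have [k sk] := exists_gt (h s).
have [j tj] := exists_gt (h t).
have [i [ki ji]] := wo_max le_wo k j.
exists i => y xy yt; apply: nxs; apply/xy; first exact: lt_le_trans sk ki.
by apply: yt st _; apply/xy => //; apply: lt_le_trans tj ji.
Qed.

(** Both halves are proved by one induction on [a]: the first uses the second at smaller ordinals,
    and the second follows by an inner induction on [b] that starts from the first. *)
Lemma Sigma0_rank_ge a : enumerable K a ->
  (forall s, olt ozero a ->
    Pi0 (omul otwo a) [set x : X | rank_ge (omul kappa a) x s]) /\
  forall b s, olt ozero b -> olt b kappa -> 
    Sigma0 (oadd (omul otwo a) oone) [set x : X | rank_ge (oadd (omul kappa a) b) x s].
Proof.
elim/(well_founded_ind olt_wf): a => a IH a_enum.
have a'1 : ole oone (oadd (omul otwo a) oone) by apply/ole_oneP/olt_omul2S/ole_zero.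
have Pi_a s : olt ozero a -> Pi0 (omul otwo a) [set x : X | rank_ge (omul kappa a) x s].
  move=> a0; have a1 := olt_one_omul2 a0; have [r ra] := a_enum.
  rewrite (_ : [set _ | _] = \bigcap_i [set x | olt (r (p i).1) a ->
      rank_ge (oadd (omul kappa (r (p i).1)) (osucc (krk le_wo (p i).2))) x s]).
    apply: Pi0_bigcapK.
      exact: olt_ole.
    move=> i; have [ja|nja] := EM (olt (r (p i).1) a).
      rewrite (_ : [set _ | _] = 
        [set x | rank_ge (oadd (omul kappa (r (p i).1))
          (osucc (krk le_wo (p i).2))) x s]).
        apply: (@Pi0_of_Sigma0_lt _ (oadd (omul otwo (r (p i).1)) oone)) => //.
          by apply/olt_omul2P; exists (r (p i).1) => //; apply: ole_refl.
        apply: (IH _ ja _).2 => //; first exact: enumerable_ole (olt_ole ja) a_enum.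
          exact: ole_olt_trans (ole_zero _) (olt_osucc _).
        exact: olt_osucc_krk.
      by apply/seteqP; split=> x /=; tauto.
    rewrite /Pi0 (_ : ~` _ = set0).
      apply: Sigma0_of_kopen.
        exact: olt_ole.
      exact: kopen0.
    by apply/seteqP; split=> // x /= []/nja.
  apply/seteqP; split=> x /= => [/(rank_ge_omulP _ _ ra) H i _|H]; first exact: H.
  apply/(rank_ge_omulP _ _ ra) => j k; have [i ijk] := p_surj (j, k).
  by have := H i I; rewrite /= ijk.
split=> //; elim/(well_founded_ind olt_wf) => b IHb s b0 bk.
have /olt_otypeP[k [bk1 bk2]] := bk.
(* As [b] is the rank of [k], the ordinals below [b] are the ranks of the fewer than kappa points
   below [k]. *)
rewrite (_ : [set _ | _] = [set x | forall j, lt j k ->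
    (\bigcup_m ([set x | x (rcons s m)] `&`
      [set x | rank_ge (oadd (omul kappa a) (krk le_wo j)) x (rcons s m)])) x]).
  apply: Sigma0_small_cap.
  move=> j jk.
  apply: Sigma0_bigcupK => // m.
  apply: Sigma0_setI.
    apply: Sigma0_of_kopen => //.
    exact: kopen_mem.
  (* When [j] has rank zero the child needs rank at least kappa * a: no condition if [a] is zero,
     and otherwise a Pi^0_{2a} one. *)
  have [j0|j0] := oleVlt (krk le_wo j) ozero; last first.
    apply: IHb => //; last by exists j; apply: ole_refl.
    by apply: olt_ole_trans bk2; apply: krk_lt.
  have [a0|a0] := oleVlt a ozero.
    rewrite (_ : [set _ | _] = setT).
      apply: Sigma0_of_kopen => //.
      exact: kopenT.
    apply/seteqP; split=> // x _ /=; apply: (@rank_ge_ole _ _ ozero) => [|[]].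
    exact: ole_trans (oadd0 _ j0) (omul0 _ a0).
  rewrite (_ : [set _ | _] = [set x | rank_ge (omul kappa a) x (rcons s m)]).
    apply: (@Sigma0_of_Pi0_lt _ (omul otwo a)) => //.
      exact: olt_ole_trans (olt_one_omul2 a0) (ole_oaddr _ _).
    - exact/olt_omul2S/ole_refl.
    - exact: Pi_a.
  apply/seteqP; split=> x /=; apply: rank_ge_ole; first exact: ole_oaddr.
  exact: oadd0.
apply/seteqP; split=> x /= => [/rank_geP H j jk|H].
  have [m [xm bm]] : exists m, x (rcons s m) /\
      rank_ge (oadd (omul kappa a) (krk le_wo j)) x (rcons s m).
    by apply: H; apply: oadd_lt2l; apply: olt_ole_trans bk2; apply: krk_lt.
  by exists m.
have {}H j : lt j k -> exists m, x (rcons s m) /\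
    rank_ge (oadd (omul kappa a) (krk le_wo j)) x (rcons s m).
  by move=> /H[m _ []]; exists m.
apply/rank_geP => z /olt_oaddP[za|[y yb zy]].
  (* For [z] below kappa * a the child given by any [j] will do; there is one because [b] is
     positive. *)
  have /olt_krkP[j jk _] := olt_ole_trans b0 bk1.
  have [m [xm bm]] := H j jk; exists m; split=> //; apply: rank_ge_ole bm.
  exact: olt_ole (olt_ole_trans za (ole_oaddr _ _)).
have /olt_krkP[j jk [yj _]] := olt_ole_trans yb bk1.
have [m [xm bm]] := H j jk; exists m; split=> //; apply: rank_ge_ole bm.
exact: ole_trans zy (oadd_le2l _ yj).
Qed.

Lemma Pi0_WF a b : enumerable K a -> olt ozero b -> olt b kappa ->
  Pi0 (oadd (omul otwo a) oone) (WF K (oadd (omul kappa a) b)).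
Proof.
move=> a_enum b0 bk; rewrite /Pi0.
rewrite (_ : ~` _ = [set x | ~ is_tree x] `|`
    [set x | rank_ge (oadd (omul kappa a) b) x [::]]).
  apply: Sigma0_setU.
    apply: Sigma0_of_kopen.
      exact/ole_oneP/olt_omul2S/ole_zero.
    exact: kopen_not_tree.
  exact: (Sigma0_rank_ge a_enum).2.
apply/seteqP; split=> x /= => [nx|[nt|xb] /WFP[]//].
have [xt|] := EM (is_tree x); [right|by left].
by apply: contrapT => nb; apply/nx/WFP.
Qed.

(** By [rank_ge_omulP] this is a union of kappa many sets [WF] at ordinals kappa * y + b with y < a
    and 0 < b < kappa, each of class Pi^0_{2y+1} with 2y + 1 < 2a. *)
Lemma Sigma0_WF a : enumerable K a -> olt ozero a ->
  Sigma0 (omul otwo a) (WF K (omul kappa a)).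
Proof.
move=> a_enum a0; have a1 := olt_one_omul2 a0; have [r ra] := a_enum.
apply/(Sigma0P _ a1).
exists (fun i => [set x | olt (r (p i).1) a /\
  WF K (oadd (omul kappa (r (p i).1)) (osucc (krk le_wo (p i).2))) x]); split.
  move=> i; have [ja|nja] := EM (olt (r (p i).1) a).
    exists (oadd (omul otwo (r (p i).1)) oone).
      by apply/olt_omul2P; exists (r (p i).1) => //; apply: ole_refl.
    rewrite (_ : [set _ | _] =
      WF K (oadd (omul kappa (r (p i).1)) (osucc (krk le_wo (p i).2)))).
      apply: Pi0_WF; first exact: enumerable_ole (olt_ole ja) a_enum.
        exact: ole_olt_trans (ole_zero _) (olt_osucc _).
      exact: olt_osucc_krk.
    by apply/seteqP; split=> x //= [].
  exists oone => //; rewrite /Pi0 (_ : ~` _ = setT).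
    apply: Sigma0_of_kopen.
      exact: ole_refl.
    exact: kopenT.
  by apply/seteqP; split=> // x _ [].
apply/seteqP; split=> x /=.
  move=> /WFP[xt nb]; apply: contrapT => nx; apply: nb.
  apply/(rank_ge_omulP _ _ ra) => j k ja; apply: contrapT => nb; apply: nx.
  have [i ijk] := p_surj (j, k); exists i => //=; rewrite ijk; split=> //.
  by apply/WFP.
move=> [i _ [ia /WFP[xt nb]]]; apply/WFP; split=> // H; apply: nb.
exact: ((rank_ge_omulP _ _ ra).1 H).
Qed.

Implicit Types (G : K -> X) (s t : seq K) (c : X).

(** * Joins of trees *)

(** The new root is always present, while an empty [G k] contributes no child. *)
Definition tree_join G : X :=
  [set s | if s is k :: t then G k t else True].

Lemma rank_ge_tree_join a G k s :
  rank_ge a (tree_join G) (k :: s) <-> rank_ge a (G k) s.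
Proof.
by elim: a s => A f IH s; split=> H i; have [m [km bm]] := H i;
   exists m; split=> //; apply/IH.
Qed.

Lemma tree_join_is_tree G : (forall k, is_tree (G k)) -> is_tree (tree_join G).
Proof.
move=> Gt [|k s] [|j t] //= /andP[/eqP <- st]; exact: Gt.
Qed.

(** * Products of trees *)

Section Product.
Variables (d : ord) (r : K -> ord) (r_enum : enumerates d r).

(* A step m of the product moves to W m in the tree of decreasing sequences in
   d, and moves to U m j in the j-th tree for every j < L m. *)
Let W m := (p m).1.
Let L m := l (p m).2.
Let U m j := u (p m).2 j.

Lemma exists_step w k (v : K -> K) : exists m,
  [/\ W m = w, L m = k & forall j, lt j k -> U m j = v j].
Proof.
have [n [nk nv]] := luP k v; have [m mE] := p_surj (w, n).
by exists m; rewrite /W /L /U mE.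
Qed.

(** As lengths never decrease, a tree that has been entered is moved in at every later step. *)
Definition descent m m' : Prop := olt (r (W m')) (r (W m)) /\ le (L m) (L m').

Definition branch j s := [seq U m j | m <- s & lt j (L m)].

(** Requiring [W m] below [L m] confines the steps of length at most [j] to ordinals indexed below
    [j]. A tree not yet entered imposes no condition, not even on its root. *)
Definition tree_prod G : X := [set s | [/\ pairwise (fun m m' => `[< descent m m' >]) s,
  all (fun m => lt (W m) (L m)) s &
  forall j, branch j s <> [::] -> G j (branch j s)]].

Lemma branch_rcons j s m : branch j (rcons s m) =
  if lt j (L m) then rcons (branch j s) (U m j) else branch j s.
Proof. by rewrite /branch filter_rcons; case: ifP => // _; rewrite map_rcons. Qed.

Lemma branch_nil j s : (forall m, m \in s -> ~ lt j (L m)) -> branch j s = [::].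
Proof.
move=> sj; rewrite /branch (_ : [seq m <- s | lt j (L m)] = [::]) //.
by apply/eqP; rewrite -(negbK (_ == _)) -has_filter; apply/hasPn => m /sj/negP.
Qed.

Lemma tree_prod_nil G : tree_prod G [::].
Proof. by split. Qed.

Lemma tree_prod_is_tree G : (forall k, is_tree (G k)) -> is_tree (tree_prod G).
Proof.
move=> Gt s t /prefixP[t' ->] [].
rewrite pairwise_cat all_cat => /and3P[_ sP _] /andP[sA _] sG; split=> // j sj.
have pre : prefix (branch j s) (branch j (s ++ t')).
  by rewrite /branch filter_cat map_cat prefix_prefix.
apply: Gt pre _; apply: sG; rewrite /branch filter_cat map_cat.
by rewrite -/(branch j s); case: (branch j s) sj.
Qed.

(** To pass from [a] to a smaller [b], step to an index of [b], with a length above that index and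
    at least all earlier lengths, and choose in every tree below this length a child of rank at
    least [b]. Trees not entered keep their rank at the root. *)
Lemma rank_ge_tree_prod G :
  (forall j, rank_ge d (G j) [::]) -> rank_ge d (tree_prod G) [::].
Proof.
suff H a s : tree_prod G s -> (forall m, m \in s -> ole a (r (W m))) -> ole a d ->
    (forall j, rank_ge a (G j) (branch j s)) -> rank_ge a (tree_prod G) s.
  by move=> Gd; apply: H => //; apply: ole_refl.
elim/(well_founded_ind olt_wf): a s => a IH s [sP sA sG] sa ad Ga.
apply/rank_geP => b ba; have [w [bw wb]] := r_enum (olt_ole_trans ba ad).
have [k [wk sk]] : exists k, lt w k /\ forall m, m \in s -> le (L m) k.
  elim: (s) => [|m s' [k [wk sk]]].
    by have [k wk] := exists_gt w; exists k.
  case/orP: (wo_total le_wo k (L m)) => km; [exists (L m)|exists k].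
    split=> [|m']; first exact: lt_le_trans wk km.
    rewrite inE => /orP[/eqP->|/sk m'k]; first exact: wo_refl.
    exact: wo_trans m'k km.
  by split=> // m'; rewrite inE => /orP[/eqP->|/sk].
have /choice[v vP] j : exists v, G j (rcons (branch j s) v) /\
    rank_ge b (G j) (rcons (branch j s) v).
  by move: (Ga j) => /rank_geP; apply.
have [m [mw mk mv]] := exists_step w k v.
have Gm j : lt j (L m) -> rcons (branch j s) (U m j) = rcons (branch j s) (v j).
  by rewrite mk => /mv ->.
exists m; have sm : tree_prod G (rcons s m).
  split.
  - rewrite pairwise_rcons sP andbT; apply/allP => m' m's; apply/asboolP.
    split; last by rewrite mk; apply: sk.
    by rewrite mw; apply: olt_ole_trans (sa _ m's); apply: ole_olt_trans ba.
  - by rewrite all_rcons sA mw mk wk.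
  move=> j; rewrite branch_rcons; case: ifP => jm; last exact: sG.
  by rewrite Gm // => _; case: (vP j).
split=> //; apply: IH => //; last 2 first.
- exact: ole_trans (olt_ole ba) ad.
- move=> j; rewrite branch_rcons; case: ifP => jm; last first.
    exact: rank_ge_ole (olt_ole ba) (Ga j).
  by rewrite Gm //; case: (vP j).
move=> m'; rewrite mem_rcons inE => /orP[/eqP->|/sa]; first by rewrite mw.
exact: ole_trans (olt_ole ba).
Qed.

Section UpperBound.
Variables (G : K -> X) (j : K).

Let R v w := lt v j /\ olt (r v) (r w).

Let R_wf : well_founded R.
Proof.
move=> w; move: {2}(r w) (ole_refl (r w)) => z.
elim/(well_founded_ind olt_wf): z w => z IH w wz; constructor => v [_ vw].
exact: IH (olt_ole_trans vw wz) _ (ole_refl _).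
Qed.

Let top := osup (fun v : {v | lt v j} => rk R_wf (sval v)).

(* Otherwise the ranks below kappa inject the kappa points of K into the fewer
   than kappa points below j. *)
Lemma olt_top : olt top kappa.
Proof.
apply: not_ole => top_ge.
have e : enumerates top (fun v : {v | lt v j} => rk R_wf (sval v)).
  apply: enumerates_approx => [z [v zv]|v z /olt_rkP[w Rw zw]].
    by exists v => //; apply: olt_osup.
  by exists (exist _ w Rw.1) => //=; apply: rk_lt.
have /choice[f fP] k : exists v : {v | lt v j}, oeq (krk le_wo k) (rk R_wf (sval v)).
  by apply: e; apply: olt_ole_trans top_ge; apply: olt_osup.
have [_] := K_initial j; apply.
apply: (injective_card_le (f := fun k => sval (f k))) => [k _|k k' _ _ E].
  exact: (svalP (f k)).
have [k1 k2] := fP k; have [k3 k4] := fP k'; apply: (krk_inj (le_wo := le_wo)).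
by split; [apply: ole_trans k1 _|apply: ole_trans k3 _]; rewrite ?E // -E.
Qed.

(** Since every later step also moves in the [j]-th tree, projecting to it sends children to
    children. *)
Lemma rank_ge_tree_prod_branch a s : (exists2 m, m \in s & lt j (L m)) ->
  rank_ge a (tree_prod G) s -> rank_ge a (G j) (branch j s).
Proof.
elim: a s => A f IH s [m0 m0s jm0] sb i; have [m [sm bm]] := sb i.
have [sP _ sG] := sm; exists (U m j).
have jm : lt j (L m).
  move: sP; rewrite pairwise_rcons => /andP[/allP /(_ _ m0s) /asboolP[_ m0m] _].
  exact: lt_le_trans jm0 m0m.
have E : branch j (rcons s m) = rcons (branch j s) (U m j) by rewrite branch_rcons jm.
rewrite -E; split; first by apply: sG; rewrite E; case: (branch j s).
by apply: IH => //; exists m; rewrite ?mem_rcons ?mem_head.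
Qed.

(* While the steps have length at most j, they descend in the order of type top
   on the points below j; afterwards the j-th tree bounds the rank. *)
Lemma not_rank_ge_tree_prod a : ~ rank_ge (osucc a) (G j) [::] ->
  ~ rank_ge (oadd a (osucc top)) (tree_prod G) [::].
Proof.
(* Invariant: no step so far enters the [j]-th tree, and [z] exceeds the rank of every point below
   [j] that may still be chosen. *)
move=> nG; suff H z s : (forall m, m \in s -> ~ lt j (L m)) ->
    (forall v, lt v j -> (forall m, m \in s -> olt (r v) (r (W m))) ->
      olt (rk R_wf v) z) ->
    ~ rank_ge (oadd a (osucc z)) (tree_prod G) s.
  by apply: H => // v vj _; exists (exist _ v vj); apply: ole_refl.
elim/(well_founded_ind olt_wf): z s => z IH s sj sz /rank_geP sb.
have [m [sm bm]] := sb _ (oadd_lt2l a (olt_osucc z)).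
have [sP sA sG] := sm.
move: sP sA; rewrite pairwise_rcons all_rcons => /andP[/allP sP _] /andP[mA _].
have [jm|njm] := EM (lt j (L m)).
  have E : branch j (rcons s m) = [:: U m j] by rewrite branch_rcons jm branch_nil.
  apply/nG/rank_ge_osuccP; exists (U m j); split.
    by have := sG j; rewrite E; apply.
  apply: rank_ge_ole (ole_oaddr a z) _; rewrite /= -E.
  by apply: rank_ge_tree_prod_branch => //; exists m; rewrite ?mem_rcons ?mem_head.
have mj : lt (W m) j by apply: lt_le_trans mA (not_lt_le le_wo njm).
have mz : olt (rk R_wf (W m)) z.
  by apply: sz => // m' /sP/asboolP[].
apply: (IH _ mz (rcons s m)).
- by move=> m'; rewrite mem_rcons inE => /orP[/eqP->|/sj].
- move=> v vj vm; apply: rk_lt; split=> //; apply: vm.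
  by rewrite mem_rcons mem_head.
- by apply: rank_ge_ole bm; apply: oadd_le2l; apply/ole_osuccP.
Qed.

Lemma not_rank_ge_tree_prod_omul a b : olt a b ->
  ~ rank_ge (osucc (omul kappa a)) (G j) [::] ->
  ~ rank_ge (omul kappa b) (tree_prod G) [::].
Proof.
move=> ab /not_rank_ge_tree_prod nb bb; apply: nb; apply: rank_ge_ole bb.
by apply: omul_oadd_le => //; apply/ole_osuccP; exact: olt_top.
Qed.

End UpperBound.
End Product.

(** * Continuous families of trees *)

(** One code stands for kappa many codes; [glue] is the converse operation. *)
Definition sect (k : K) c : X := [set s | c (k :: s)].

Definition cont2 (F : X -> X -> X) : Prop := forall s, exists k, forall c c' x x',
  agree k c c' -> agree k x x' -> (F c x s <-> F c' x' s).

(* Whether s belongs to P G depends on one node of each of fewer than kappa many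
   of the G j. *)
Definition local (P : (K -> X) -> X) : Prop := forall s, exists k (t : K -> seq K),
  forall G G', (forall j, lt j k -> (G j (t j) <-> G' j (t j))) ->
  (P G s <-> P G' s).

Lemma agree_sect j k : exists i, forall c c', agree i c c' ->
  agree k (sect j c) (sect j c').
Proof.
have [i iP] : exists i, forall s, lt (h s) k -> lt (h (j :: s)) i.
  by apply: (bounded_fun (fun s => h (j :: s)) h_inj); exists k.
by exists i => c c' cc' s /iP/cc'.
Qed.

(** Each of the fewer than kappa nodes consulted depends on a bounded part of the arguments, and
    regularity gives a common bound. *)
Lemma local_cont2 (P : (K -> X) -> X) (F : K -> X -> X -> X) : local P ->
  (forall j, cont2 (F j)) -> cont2 (fun c x => P (fun j => F j (sect j c) x)).
Proof.
move=> Pl Fc s; have [k [t kt]] := Pl s.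
have /choice[f fP] j : exists i, forall c c' x x', agree i c c' ->
    agree i x x' -> (F j (sect j c) x (t j) <-> F j (sect j c') x' (t j)).
  have [i iP] := Fc j (t j); have [i' i'P] := agree_sect j i.
  have [m [im i'm]] := wo_max le_wo i i'.
  exists m => c c' x x' cc xx; apply: iP; last exact: (agree_le im).
  by apply: i'P; apply: (agree_le i'm).
have [i iP] : exists i, forall j, lt j k -> lt (f j) i.
  by apply: (bounded_fun f (@inj_id _)); exists k.
exists i => c c' x x' cc xx; apply: kt => j /iP/lt_le ji.
by apply: fP; apply: (agree_le ji).
Qed.

Lemma tree_join_local : local tree_join.
Proof.
case=> [|i s].
  by have [k0] := K_inhabited; exists k0, (fun=> [::]).
have [k ik] := exists_gt i.
by exists k, (fun=> s) => G G' /(_ i ik).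
Qed.

Lemma tree_prod_local r : local (tree_prod r).
Proof.
move=> s; have [k sk] : exists k, forall m, m \in s -> le (l (p m).2) k.
  elim: s => [|m s [k sk]]; first by have [k0] := K_inhabited; exists k0.
  have [i [ki mi]] := wo_max le_wo k (l (p m).2); exists i => m'.
  by rewrite inE => /orP[/eqP->//|/sk m'k]; apply: wo_trans m'k ki.
have sub G G' : (forall j, lt j k -> (G j (branch j s) <-> G' j (branch j s))) ->
    tree_prod r G s -> tree_prod r G' s.
  move=> GG [sP sA sG]; split=> // j sj; apply/GG; last exact: sG.
  apply: contrapT => njk; apply: sj; apply: branch_nil => m /sk mk jm.
  by apply: njk; apply: lt_le_trans jm mk.
exists k, (fun j => branch j s) => G G' GG; split; apply: sub => // j jk.
exact: iff_sym (GG j jk).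
Qed.

(** * Hardness *)

Definition glue (b : K -> X) : X := [set s | if s is k :: t then b k t else False].

Definition reduces (F : X -> X -> X) (a d : ord) (A : set X) : Prop :=
  exists c, forall x, (A x -> ~ rank_ge a (F c x) [::]) /\
                      (~ A x -> rank_ge d (F c x) [::]).

Section Hard.
Variables (d : ord) (r : K -> ord) (r_enum : enumerates d r).

(** A single [F] serves all sets of the class and only the code varies; the diagonal argument relies
    on this. *)
Definition hard (a : ord) (C : set (set X)) : Prop := exists F,
  [/\ cont2 F, forall c x, is_tree (F c x) & forall A, C A -> reduces F a d A].

(** The code of a closed set lists the [nbhd m] that miss it. The join has a child exactly when [x]
    lies in a listed one, and below it the fixed tree [T] of rank at least [d]. *)
Lemma hard_Pi0_1 : hard (osucc (omul kappa ozero)) (Pi0 oone).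
Proof.
pose T := tree_prod r (fun=> setT).
have Td : rank_ge d T [::].
  have [k0] := K_inhabited.
  apply: rank_ge_tree_prod => // j.
  have : forall a s, rank_ge a [set: seq K] s; last exact.
  by elim=> A f IH s /= i; exists k0; split.
pose F m c x : X := [set s | [/\ c [::], nbhd m x & T s]].
exists (fun c x => tree_join (fun m => F m (sect m c) x)); split.
- apply: local_cont2 tree_join_local _ => m s.
  have [k hk] := exists_gt (h [::]).
  have [i [ki mi]] := wo_max le_wo k (l m); exists i.
  have sub c c' x x' : agree i c c' -> agree i x x' -> F m c x s -> F m c' x' s.
    move=> cc xx [c0 xm Ts]; split=> //.
      by apply/cc => //; apply: lt_le_trans hk ki.
    move=> t tm; rewrite -(xm t tm); apply: iff_sym; apply: xx.
    exact: lt_le_trans tm mi.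
  move=> c c' x x' cc xx; split; apply: sub => //; exact: agree_sym.
- move=> c x; apply: tree_join_is_tree => m s t st [c0 xm Tt]; split=> //.
  by apply: tree_prod_is_tree st Tt => k.
move=> A /(Sigma0_kopen (ole_refl _)) Ao.
exists (glue (fun m => [set _ | nbhd m `<=` ~` A])) => x; split=> Ax.
  move=> /rank_ge_osuccP[m [[/= mA xm _] _]].
  exact: mA xm Ax.
have [m mx mA] := kopen_nbhd Ao Ax.
apply: (rank_ge_ole (olt_ole (olt_osucc d))); apply/rank_ge_osuccP; exists m; split.
  by split=> //; apply: tree_prod_nil.
apply/rank_ge_tree_join; rewrite (_ : F _ _ _ = T) //.
by apply/seteqP; split=> s; [case|].
Qed.

(** Factor [j] of the product is assigned a member of the union together with a guess [b j] for its
    level. That roots always belong to the trees is needed when they are joined. *)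
Lemma hard_Sigma0 a : enumerable K a -> olt ozero a ->
  (forall b, olt b a -> 
    hard (osucc (omul kappa b)) (Pi0 (oadd (omul otwo b) oone))) ->
  exists F, [/\ cont2 F, forall c x, is_tree (F c x), forall c x, F c x [::] &
    forall A, Sigma0 (omul otwo a) A -> reduces F (omul kappa a) d A].
Proof.
move=> [e ea] a0 IH.
pose b j := if `[< olt (e (p j).2) a >] then e (p j).2 else ozero.
have ba j : olt (b j) a by rewrite /b; case: asboolP.
have /choice[F FP] j := IH _ (ba j).
exists (fun c x => tree_prod r (fun j => F j (sect j c) x)); split.
- by apply: local_cont2; [apply: tree_prod_local|move=> j; case: (FP j)].
- by move=> c x; apply: tree_prod_is_tree => j; case: (FP j).
- by move=> c x; apply: tree_prod_nil.
move=> A /(Sigma0P _ (olt_one_omul2 a0)).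
move=> [B [BP ->]].
(* A wrong guess of the level replaces the set by the empty one, whose factor always has rank at
   least [d] and so does no harm. *)
pose B' j := [set x | Pi0 (oadd (omul otwo (b j)) oone) (B (p j).1) /\ B (p j).1 x].
have B'P j : Pi0 (oadd (omul otwo (b j)) oone) (B' j).
  have [H|nH] := EM (Pi0 (oadd (omul otwo (b j)) oone) (B (p j).1)).
    by rewrite (_ : B' j = B (p j).1) //; apply/seteqP; split=> x; [case|].
  rewrite /Pi0 (_ : ~` _ = setT).
    apply: Sigma0_of_kopen.
      exact/ole_oneP/olt_omul2S/ole_zero.
    exact: kopenT.
  by apply/seteqP; split=> // x _ [].
have /choice[c cP] j : reduces (F j) (osucc (omul kappa (b j))) d (B' j).
  by have [_ _] := FP j; apply.
exists (glue c) => x; split=> [[k _ kx]|nx].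
  have [z /olt_omul2P[y ya zy] zB] := BP k.
  have [i [yi iy]] := ea y ya.
  have [j jE] := p_surj (k, i).
  have bE : b j = e i.
    by rewrite /b jE /=; case: asboolP => // -[]; apply: ole_olt_trans iy ya.
  apply: (not_rank_ge_tree_prod_omul (j := j) (ba j)).
  have [+ _] := cP j x; apply; split; rewrite jE //=.
  apply: (Sigma0_ole _ zB).
  by apply: ole_trans zy _; rewrite bE; apply: oadd_le2r; apply: omul_le2l.
apply: rank_ge_tree_prod => // j; have [_] := cP j x; apply=> -[_ jx].
by apply: nx; exists (p j).1.
Qed.

(** For positive [a] the set is an intersection of kappa many Sigma^0_{2a} sets. Subtrees of rank
    below kappa * a join to rank at most kappa * a, and one subtree of rank at least [d] makes the
    join as large. *)
Lemma hard_Pi0 a : enumerable K a ->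
  hard (osucc (omul kappa a)) (Pi0 (oadd (omul otwo a) oone)).
Proof.
elim/(well_founded_ind olt_wf): a => a IH a_enum.
have {}IH b : olt b a -> hard (osucc (omul kappa b)) (Pi0 (oadd (omul otwo b) oone)).
  by move=> ba; apply: IH => //; apply: enumerable_ole (olt_ole ba) a_enum.
have [a0|a0] := oleVlt a ozero.
  have [F [Fc Ft FP]] := hard_Pi0_1; exists F; split=> // A aA.
  have [|c cP] := FP A.
    apply: (Sigma0_ole _ aA).
    apply: ole_trans (oadd_le2r _ (omul0 otwo a0)) _.
    by apply: oleP => z /olt_oaddP[[[]]|[y /olt_osuccP y0 zy]];
       apply/olt_osuccP; apply: ole_trans zy (oadd0 _ y0).
  exists c => x; have [cA cnA] := cP x; split=> // Ax bx; apply: cA Ax _.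
  apply: rank_ge_ole bx; apply/ole_osuccP/olt_osuccP.
  by apply: omul_le2l; apply: ole_zero.
have [F [Fc Ft F0 FP]] := hard_Sigma0 a_enum a0 IH.
exists (fun c x => tree_join (fun j => F (sect j c) x)); split.
- exact: (local_cont2 (F := fun=> F) tree_join_local (fun=> Fc)).
- by move=> c x; apply: tree_join_is_tree.
move=> A; have a1 : olt oone (oadd (omul otwo a) oone).
  exact: olt_ole_trans (olt_one_omul2 a0) (ole_oaddr _ _).
move=> /(Sigma0P _ a1)[B [BP AB]].
have /choice[c cP] j : reduces F (omul kappa a) d (~` B j).
  apply: FP; have [b /olt_omul2S ba] := BP j.
  exact: (Sigma0_ole ba).
exists (glue c) => x; split=> Ax.
  move=> /rank_ge_osuccP[j [_ /rank_ge_tree_join bj]]; have [+ _] := cP j x; apply=> //.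
  by move=> jx; have : (~` A) x by rewrite AB; exists j.
have : (~` A) x by [].
rewrite AB => -[j _ jx]; apply: (rank_ge_ole (olt_ole (olt_osucc d))).
apply/rank_ge_osuccP; exists j; split; first exact: F0.
by apply/rank_ge_tree_join; have [_] := cP j x; apply; rewrite /setC /=; tauto.
Qed.

End Hard.

(** * Diagonalization *)

Lemma cont2_diag F : cont2 F -> cont (fun c => F c c).
Proof. by move=> Fc s; have [k kP] := Fc s; exists k => x y xy; apply: kP. Qed.

(** The gap from [a] to [d] lets one reduction settle every [b] in between: a code of the diagonal
    set, put in for both arguments, contradicts itself. *)
Lemma hard_not_dual F a b d (A := WF K b) (C : set (set X)) : 
  cont2 F -> (forall c x, is_tree (F c x)) -> ole a b -> ole b d ->
  (forall B, C B -> reduces F a d B) ->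
  ~ C [set c | ~ A (F c c)].
Proof.
move=> Fc Ft ab bd FP /FP[c /(_ c)[cA cnA]].
have [H|H] := EM (A (F c c)).
  by have /WFP[_] := H; apply; apply: rank_ge_ole bd _; apply: cnA => /(_ H).
apply: (H); apply/WFP; split; first exact: Ft.
by move=> /(rank_ge_ole ab); apply: cA.
Qed.

Lemma enumerable_osucc a : enumerable K a -> enumerable K (osucc a).
Proof.
move=> [e ea]; have [k0] := K_inhabited.
have [k1 k01] := exists_gt k0.
exists (fun i => if (p i).1 == k0 then a else e (p i).2) => z /olt_osuccP za.
have [az|/ea[k zk]] := oleVlt a z.
  by have [i iE] := p_surj (k0, k0); exists i; rewrite iE eqxx; split.
have [i iE] := p_surj (k1, k); exists i; rewrite iE; case: eqP => //= E.
by move: k01; rewrite E => /lt_irr.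
Qed.

Lemma enumerable_omul a : enumerable K a -> enumerable K (omul kappa a).
Proof.
move=> [e ea].
pose f i := if `[< olt (e (p i).1) a >]
  then oadd (omul kappa (e (p i).1)) (krk le_wo (p i).2) else ozero.
have fP (y w : ord) : olt y a -> olt w kappa -> exists i j k, 
    [/\ f i = oadd (omul kappa (e j)) (krk le_wo k), oeq y (e j) & oeq w (krk le_wo k)].
  move=> ya /olt_otypeP[k wk]; have [j yj] := ea y ya.
  have [i iE] := p_surj (j, k); exists i, j, k; split=> //.
  by rewrite /f iE /=; case: asboolP => // -[]; apply: ole_olt_trans yj.2 ya.
have krk_kappa k : olt (krk le_wo k) kappa by apply: olt_osup.
exists f; apply: enumerates_approx => [z /olt_omulP[y [w [ya wk zyw]]]|i z].
  have [i [j [k [iE yj wk']]]] := fP y w ya wk; exists i; rewrite iE.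
    apply: ole_trans zyw _; apply: ole_trans (oadd_le2l _ wk'.1) _.
    by apply: oadd_le2r; apply: omul_le2l yj.1.
  by apply: omul_lt => //; apply: ole_olt_trans yj.2 ya.
rewrite {1}/f; case: asboolP => [ia|_ [[]]//].
have fi : f i = oadd (omul kappa (e (p i).1)) (krk le_wo (p i).2).
  by rewrite /f; case: asboolP.
rewrite fi => /olt_oaddP[/olt_omulP[y [w [yi wk zyw]]]|[y yi zy]].
  have [i' [j [k [iE yj wk']]]] := fP y w (olt_trans yi ia) wk; exists i'; rewrite iE.
    apply: ole_trans zyw _; apply: ole_trans (oadd_le2l _ wk'.1) _.
    by apply: oadd_le2r; apply: omul_le2l yj.1.
  apply: olt_ole_trans (ole_oaddr _ _); apply: omul_lt => //.
  exact: ole_olt_trans yj.2 yi.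
have /olt_krkP[k kp yk] := yi.
have [i' iE] := p_surj ((p i).1, k); exists i'.
  rewrite /f iE /=; case: asboolP => // _.
  by apply: ole_trans zy (oadd_le2l _ yk.1).
rewrite {1}/f iE /=; case: asboolP => // _.
by apply: oadd_lt2l; exact: krk_lt.
Qed.

Lemma not_Pi0_WF a : enumerable K a -> olt ozero a ->
  ~ Pi0 (omul otwo a) (WF K (omul kappa a)).
Proof.
(* Here [d] is kappa * a itself. *)
move=> a_enum a0; have [r rP] := enumerable_omul a_enum.
have [|F [Fc Ft _ FP]] := hard_Sigma0 rP a_enum a0.
  by move=> b ba; apply: (hard_Pi0 rP); apply: enumerable_ole (olt_ole ba) a_enum.
move=> /(Sigma0_preimage (cont2_diag Fc)).
exact: (hard_not_dual Fc Ft (ole_refl _) (ole_refl _) FP).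
Qed.

Lemma not_Sigma0_WF a b : enumerable K a -> olt ozero b -> olt b kappa ->
  ~ Sigma0 (oadd (omul otwo a) oone) (WF K (oadd (omul kappa a) b)).
Proof.
(* Here [d] is kappa * (a + 1), which lies above kappa * a + b for every b < kappa. *)
move=> a_enum b0 bk; have [r rP] := enumerable_omul (enumerable_osucc a_enum).
have [F [Fc Ft FP]] := hard_Pi0 rP a_enum.
move=> /(Sigma0_preimage (cont2_diag Fc)).
have ab : ole (osucc (omul kappa a)) (oadd (omul kappa a) b).
  apply/ole_osuccP/olt_oaddP; right; exists ozero => //; exact: ole_oaddr.
have bd : ole (oadd (omul kappa a) b) (omul kappa (osucc a)).
  by apply/olt_ole/omul_lt => //; apply: olt_osucc.
move=> H; apply: (hard_not_dual Fc Ft ab bd FP); rewrite /Pi0.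
by rewrite -[X in Sigma0 _ X]setCK in H.
Qed.

End Kappa.

Theorem theorem8p10 (K : eqType) (le : rel K) (le_wo : well_order le)
    (K_initial : initial_ordinal le) (K_regular : regular le)
    (K_uncountable : ~ countable [set: K]%classic)
    (K_powers : small_powers le) :
  let kappa := otype le_wo in
  let kappa_plus := osucc_card K in
  (forall alpha : ord, ole oone alpha -> olt alpha kappa_plus ->
     Sigma0 (omul otwo alpha) (WF K (omul kappa alpha)) /\
     ~ Pi0 (omul otwo alpha) (WF K (omul kappa alpha))) /\
  (forall alpha beta : ord, olt alpha kappa_plus ->
     olt ozero beta -> olt beta kappa ->
     Pi0 (oadd (omul otwo alpha) oone) (WF K (oadd (omul kappa alpha) beta)) /\
     ~ Sigma0 (oadd (omul otwo alpha) oone)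
         (WF K (oadd (omul kappa alpha) beta))).

Proof.
move=> kappa kappa_plus.
have [l [u luP]] := exists_fun_code K_uncountable K_powers.
have [h h_inj] := exists_seq_code le_wo K_regular K_uncountable K_powers.
have [p p_surj] := exists_pair_code le_wo K_regular K_uncountable K_powers.
split=> [alpha /ole_oneP a0 /enumerable_osucc_card a_enum|
         alpha beta /enumerable_osucc_card a_enum b0 bk].
  split.
    exact: (Sigma0_WF le_wo K_initial K_regular K_uncountable h_inj luP p_surj).
  exact: (not_Pi0_WF K_initial K_regular K_uncountable h_inj luP p_surj).
split; first exact: (Pi0_WF K_initial K_regular K_uncountable h_inj luP p_surj).
exact: (not_Sigma0_WF K_initial K_regular K_uncountable h_inj luP p_surj).
Qed.
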